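(* Let $a\ge 3$ be an odd integer such that $(2b+1)^2<a<a+2<(2b+3)^2$ for some integer $b\ge 1$. Then the largest perfect square not belonging to $\langle a,a+2\rangle$ is $$ {}^{2}r(\langle a,a+2\rangle)=(a-(2b+1))^2 . $$
   Context: $\langle s_1,s_2\rangle=\{x_1s_1+x_2s_2 : x_1,x_2 \text{ integers},\ x_1,x_2\ge 0\}$. For a numerical semigroup $S$ with $1\notin S$ (generated by relatively prime positive integers), ${}^{2}r(S)$ denotes the largest perfect square $m^2$ ($m\ge 1$ an integer) not belonging to $S$. *)

(* Defs.v *)
From mathcomp Require Import all_boot.

Set Implicit Arguments.
Unset Strict Implicit.
Unset Printing Implicit Defensive.

Definition semigroup2 (s1 s2 : nat) (n : nat) : Prop :=
  exists x1 x2 : nat, n = x1 * s1 + x2 * s2.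

Definition positive_square (v : nat) : Prop :=
  exists2 m : nat, 0 < m & v = m ^ 2.

(* [largest_missing_square S v] is the equation r(S) = v for the square
   analogue of the Frobenius number.  It is a relation because r(S) is defined
   only for some S; such a v is unique when it exists. *)
Definition largest_missing_square (S : nat -> Prop) (v : nat) : Prop :=
  [/\ positive_square v, ~ S v &
      forall w : nat, positive_square w -> ~ S w -> w <= v].

(* Main.v *)
Require Import Defs.
From mathcomp Require Import all_boot.
From mathcomp Require Import zify.

Set Implicit Arguments.
Unset Strict Implicit.
Unset Printing Implicit Defensive.

(** Since [x1 * a + x2 * (a + 2) = (x1 + x2) * a + 2 * x2], the elements of
    the semigroup are the [k * a + e] with [e] even and [e <= 2 * k].  For [a]
    odd, the representation of [n = q * a + r], [r < a], that uses as many
    generators as possible is [k = q], [e = r] when [r] is even; when [r] is odd,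
    one multiple of [a] must be moved into the remainder to make it even:
    [k = q - 1], [e = r + a].  This yields the membership criterion
    [semigroup2_divn_eq].

    Write [c = 2 * b + 1].  The square of [a - d] is [(a - 2 * d) * a + d ^ 2],
    so for [d <= c] the criterion applies with remainder [d ^ 2 < a].  For an
    odd [d] it becomes [(d + 2) ^ 2 <= a + 2].  The hypotheses place
    [a] and [a + 2] strictly between the consecutive odd squares [c ^ 2] and
    [(c + 2) ^ 2], so [c] is the least odd [d] at which this inequality fails;
    for an even [d < c] the criterion always holds.  Finally the squares from
    [a ^ 2] on have quotient at least [a], and every such number is in the
    semigroup. *)

(** Subtracting the two representations gives [2 * x2 = (q - k) * a + r] with
    [k = x1 + x2], so [q - k] has the parity of [r].  An odd [r] therefore costs
    [q - k >= 1], and [r + a <= 2 * x2 <= 2 * k <= 2 * (q - 1)] is the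
    source of the extra [a + 2]. *)
Lemma semigroup2_divn_eq a q r : odd a -> r < a ->
  semigroup2 a (a + 2) (q * a + r) <-> r + odd r * (a + 2) <= 2 * q.
Proof.
move=> a_odd lt_ra; split=> [[x1 [x2 def_n]]|].
  have {}def_n : q * a + r = (x1 + x2) * a + 2 * x2 by rewrite def_n; nia.
  have le_kq : x1 + x2 <= q.
    rewrite leqNgt; apply/negP=> lt_qk.
    have := leq_mul2r a q.+1 (x1 + x2); rewrite lt_qk orbT mulSn; lia.
  have [t def_q] : exists t, q = x1 + x2 + t by exists (q - (x1 + x2)); lia.
  have def_x2 : 2 * x2 = t * a + r by move: def_n; rewrite def_q mulnDl; lia.
  have odd_t : odd t = odd r.
    have := congr1 odd def_x2.
    by rewrite mul2n odd_double oddD oddM a_odd andbT; case: odd; case: odd.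
  case r_odd: (odd r); last by lia.
  have t_gt0 : 0 < t by case: t odd_t {def_q def_x2}; rewrite r_odd.
  have : a <= t * a by apply: leq_pmull.
  by lia.
case r_odd: (odd r) => /= le_rq; last first.
  by exists (q - r./2), r./2; have := odd_double_half r; rewrite r_odd; nia.
have := odd_double_half (r + a); rewrite oddD r_odd a_odd /= add0n => def_e.
have [q' def_q] : exists q', q = q'.+1 by exists q.-1; lia.
subst q; exists (q' - (r + a)./2), (r + a)./2.
set e := (r + a)./2 in def_e *.
have [x def_q'] : exists x, q' = x + e by exists (q' - e); lia.
by rewrite def_q' addnK; nia.
Qed.

Lemma sqrn_sub_divn_eq a d : 2 * d <= a ->
  (a - d) ^ 2 = (a - 2 * d) * a + d ^ 2.
Proof.
move=> le_da; have [x ->] : exists x, a = x + 2 * d by exists (a - 2 * d); lia.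
by rewrite addnK (_ : x + 2 * d - d = x + d); [nia | lia].
Qed.

(** The largest integer outside the semigroup is in fact [a ^ 2 - 2]: from
    [a ^ 2] on the quotient by [a] is large enough even for the largest odd
    remainder, which is [a - 2]. *)
Lemma semigroup2_ge_sqr a n : odd a -> a ^ 2 <= n ->
  semigroup2 a (a + 2) n.
Proof.
move=> a_odd le_a2n; have a_gt0 : 0 < a by apply: odd_gt0.
have lt_ra : n %% a < a by rewrite ltn_mod.
have le_aq : a <= n %/ a by rewrite leq_divRL // mulnn.
rewrite (divn_eq n a); apply/semigroup2_divn_eq => //.
case r_odd: (odd (n %% a)); last by lia.
have : (n %% a).+1 != a by apply: contraTneq a_odd => <-; rewrite /= r_odd.
by lia.
Qed.

Theorem proposition5p1 (a b : nat) (a_ge3 : 3 <= a) (a_odd : odd a)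
    (b_ge1 : 1 <= b)
    (lt_sqr_a : (2 * b + 1) ^ 2 < a) (lt_a_a2 : a < a + 2)
    (lt_a2_sqr : a + 2 < (2 * b + 3) ^ 2) :
  largest_missing_square (semigroup2 a (a + 2)) ((a - (2 * b + 1)) ^ 2).
Proof.
set c := 2 * b + 1 in lt_sqr_a *.
have c_odd : odd c by rewrite /c mul2n oddD odd_double.
have c_ge3 : 3 <= c by rewrite /c; lia.
have {}lt_a2_sqr : a + 2 < (c + 2) ^ 2 by rewrite /c -addnA.
have le_3c_a : 3 * c <= a.
  by apply: leq_trans (ltnW lt_sqr_a); rewrite -mulnn leq_mul2r c_ge3 orbT.
split.
- by exists (a - c) => //; lia.
- rewrite sqrn_sub_divn_eq; last by lia.
  by move/(semigroup2_divn_eq _ a_odd lt_sqr_a); rewrite oddX c_odd /=; nia.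
move=> _ [m m_gt0 ->] m2_missing; rewrite leq_exp2r // leqNgt.
apply/negP=> lt_m; apply: m2_missing.
have [le_am | lt_ma] := leqP a m.
  by apply: semigroup2_ge_sqr => //; rewrite leq_exp2r.
have [d def_m] : exists d, m = a - d by exists (a - m); lia.
have lt_dc : d < c by lia.
have lt_d2a : d ^ 2 < a.
  by apply: leq_trans lt_sqr_a; rewrite ltnS leq_exp2r // ltnW.
rewrite def_m sqrn_sub_divn_eq; last by lia.
apply/(semigroup2_divn_eq _ a_odd lt_d2a); rewrite oddX /=.
case d_odd: (odd d); last first.
  have : d.+1 ^ 2 <= c ^ 2 by rewrite leq_exp2r.
  by nia.
have lt_d1c : d.+1 < c.
  have : d.+1 != c by apply: contraTneq c_odd => <-; rewrite /= d_odd.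
  by lia.
have : (d + 2) ^ 2 <= c ^ 2 by rewrite leq_exp2r // addn2.
by nia.
Qed.
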